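(* Let $r,s\ge0$ be integers, $a,b,c,d\in\mathbb{C}$, $\mathbf{e}\in\mathbb{C}^r$, $\mathbf{f}\in\mathbb{C}^s$. Put $t=r+s+8$ and, for an integer $n\ge0$, $\hat{a}_n=1-a-n$, $\hat{b}_n=1-b-n$, $\hat{c}_n=1-c-n$, $\hat{d}_n=1-d-n$. Then, whenever all terms are well defined (no denominator vanishes), $$\frac{(b-d)(c-d)(a-1)_{2}(b+c-a-1)_{2}}{(a+n-1)(b+c-a+n-1)}\;{}_{t}F_{t-1}\!\left(\left.\begin{matrix}-n,\,\hat{b}_n-c+d+1,\,b+c-a+1,\,c,\,d,\,\hat{a}_n,\,\hat{b}_n+1,\,b+c,\,\mathbf{e},\,2-\mathbf{f}-n \\ {b}+c-d+1,\,\hat{b}_n-c+a+1,\,\hat{c}_n,\,\hat{d}_n,\,a,\,b+1,\,\hat{b}_n-c+2,\,2-\mathbf{e}-n,\,\mathbf{f}\end{matrix}\right|(-1)^{t}\right)$$ $$-\frac{(b-a)(c-a)(d-1)_{2}(b+c-d-1)_{2}}{(d+n-1)(b+c-d+n-1)}\;{}_{t}F_{t-1}\!\left(\left.\begin{matrix}-n,\,\hat{b}_n-c+d,\,b+c-a,\,c,\,d+1,\,\hat{a}_n+1,\,\hat{b}_n+1,\,b+c,\,\mathbf{e},\,2-\mathbf{f}-n \\ {b}+c-d,\,\hat{b}_n-c+a,\,\hat{c}_n,\,\hat{d}_n+1,\,a+1,\,b+1,\,\hat{b}_n-c+2,\,2-\mathbf{e}-n,\,\mathbf{f}\end{matrix}\right|(-1)^{t}\right)$$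 $$=\frac{(a-d)(b+c-a-d)(b-1)_{2}(c-1)_{2}}{(b+n-1)(c+n-1)}\;{}_{t}F_{t-1}\!\left(\left.\begin{matrix}-n,\,\hat{b}_n-c+d+1,\,b+c-a,\,c+1,\,d,\,\hat{a}_n+1,\,\hat{b}_n,\,b+c,\,\mathbf{e},\,2-\mathbf{f}-n \\ {b}+c-d+1,\,\hat{b}_n-c+a,\,\hat{c}_n+1,\,\hat{d}_n,\,a+1,\,b,\,\hat{b}_n-c+2,\,2-\mathbf{e}-n,\,\mathbf{f}\end{matrix}\right|(-1)^{t}\right).$$
   Context: $(u)_k=u(u+1)\cdots(u+k-1)$. ${}_tF_{t-1}(\mathbf{u};\mathbf{v}|z)=\sum_{k\ge0}\frac{\prod_i(u_i)_k}{\prod_i(v_i)_k}\frac{z^k}{k!}$; here each series terminates at $k=n$ because of the upper parameter $-n$. Vectors in parameter lists denote the lists of their components, and operations with scalars are componentwise, e.g. $2-\mathbf{f}-n=(2-f_1-n,\dots,2-f_s-n)$. *)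

(* Defs.v *)
From mathcomp Require Import all_boot all_order all_algebra.
From mathcomp Require Import complex.
From mathcomp Require Import all_classical all_reals all_analysis.
Set Implicit Arguments.
Unset Strict Implicit.
Unset Printing Implicit Defensive.
Import Order.TTheory GRing.Theory Num.Theory.
Import numFieldNormedType.Exports.
Local Open Scope ring_scope.

(* (u)_k = u (u + 1) ... (u + k - 1). *)
Definition pochhammer (K : numFieldType) (u : K) (k : nat) : K :=
  \prod_(i < k) (u + i%:R).

(* Since 0^-1 = 0 in K, a term with both a vanishing numerator and a vanishing
   denominator is 0.  Hence, if -n is among the upper parameters, the series
   stops at k = n even when some (w)_k vanishes for a k > n. *)
Definition hypergeometric_term (K : numFieldType) (u v : seq K) (z : K)
    (k : nat) : K :=
  (\prod_(w <- u) pochhammer w k) / (\prod_(w <- v) pochhammer w k)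
  * (z ^+ k / (k`!)%:R).

Definition hypergeometric (K : numFieldType) (u v : seq K) (z : K) : K :=
  limn (series (hypergeometric_term u v z)).

(* No denominator vanishes in the terms k <= n of a series with lower
   parameters v. *)
Definition lower_defined (K : numFieldType) (n : nat) (v : seq K) : Prop :=
  forall k : nat, (k <= n)%N -> \prod_(w <- v) pochhammer w k != 0.

(* Main.v *)
(* Each upper parameter is paired with a lower one whose sum with it is 1 - n,
   2 - n or 3 - n, and the sign (-1)^t makes each pair contribute
   (-1)^k (u)_k / (w)_k, which up to a simple factor is invariant under the
   reflection k <-> j = n - 1 - k.  The pairs coming from e and f are exactly
   invariant.  Put s = b + c, A = a (s - a), B = b c, D = d (s - d),
   p = k (k + s), q = j (j + s).  The combination of the k-th terms of the three
   series is then a reflection-invariant quantity times p - q, because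
   (B - D) g(A) - (B - A) g(D) - (A - D) g(B) with
   g(z) = (z + 1 - s) (z + p) / (z + q) kills the affine part of g and retains
   (1 - s - q) (p - q) / (z + q).  So the terms k and n - 1 - k cancel, and the
   term k = n vanishes by itself. *)

Require Import Defs.
From mathcomp Require Import all_boot all_order all_algebra.
From mathcomp Require Import complex.
From mathcomp Require Import all_classical all_reals all_analysis.
From mathcomp Require Import ring.
Import Order.TTheory GRing.Theory Num.Theory.
Local Open Scope ring_scope.

(** * Rational identities behind the inner terms, the last term and the case n = 0 *)

Section RationalIdentities.
Variable K : fieldType.

(** A divided difference cleared of denominators: modulo an affine function of z, (z + w) (z + p) /
    (z + q) equals (w - q) (p - q) / (z + q), and the second divided difference of 1 / (z + q) at A,
    B, D is 1 / ((A + q) (B + q) (D + q)). *)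
Lemma lagrange_combination (A B D w p q : K) :
  (B - D) * ((A + w) * (A + p) * (B + q) * (D + q))
  - (B - A) * ((D + w) * (D + p) * (A + q) * (B + q))
  - (A - D) * ((B + w) * (B + p) * (A + q) * (D + q))
  = (B - D) * (B - A) * (A - D) * (q - w) * (p - q).
Proof. by ring. Qed.

(* [wa], ..., [wy] stand for values of [weight] below; [sh] and [ba] are the
   shifted and balanced ratios in terms of them, and k + j = n - 1. *)
Lemma inner_combination (a b c d k j wa wb wc wd wx wy : K) :
  let s := b + c in let m := k + j in
  let y := s - a in let x := s - d in
  a + m != 0 -> b + m != 0 -> c + m != 0 -> d + m != 0 -> x + m != 0 -> y + m != 0 ->
  a + k != 0 -> b + k != 0 -> x + k != 0 ->
  a + j != 0 -> b + j != 0 -> x + j != 0 ->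
  c != 0 -> d != 0 -> y != 0 ->
  let sh u w := w * (u + k) * (u + m) / u in
  let ba u w := w * (u + j) in
  (b - d) * (c - d) * ((a - 1) * a) * ((y - 1) * y) / ((a + m) * (y + m))
    * ((sh x wx)^-1 * sh y wy * ba c wc * ba d wd * (ba a wa)^-1 * (sh b wb)^-1)
  - (b - a) * (c - a) * ((d - 1) * d) * ((x - 1) * x) / ((d + m) * (x + m))
    * ((ba x wx)^-1 * ba y wy * ba c wc * sh d wd * (sh a wa)^-1 * (sh b wb)^-1)
  - (a - d) * (s - a - d) * ((b - 1) * b) * ((c - 1) * c) / ((b + m) * (c + m))
    * ((sh x wx)^-1 * ba y wy * sh c wc * ba d wd * (sh a wa)^-1 * (ba b wb)^-1)
  = (wy * wc * wd / (wx * wa * wb)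
     * (x * a * b * (b - d) * (c - d) * (b - a) * (c - a) * (a - d) * (s - a - d))
     / ((x + m) * (a + m) * (b + m)
        * ((a + k) * (a + j) * ((b + k) * (b + j)) * ((x + k) * (x + j)))))
    * (1 + j) * (s - 1 + j) * (k * (k + s) - j * (j + s)).
Proof.
move=> s m y x am bm cm dm xm ym ak bk xk aj bj xj c0 d0 y0 sh ba.
(* The pairs a, y and b, c and d, x all have sum s, so shifting both members of a pair by t only
   adds t (t + s) to their product. *)
have quad u t : (u + t) * (s - u + t) = u * (s - u) + t * (t + s) by ring.
have bE t : (b + t) * (c + t) = b * c + t * (t + s) by rewrite /s; ring.
have bd : (b - d) * (c - d) = b * c - d * x by rewrite /x /s; ring.
have ba' : (b - a) * (c - a) = b * c - a * y by rewrite /y /s; ring.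
have ad : (a - d) * (s - a - d) = a * y - d * x by rewrite /y /x; ring.
have key : (b - d) * (c - d)
      * ((a - 1) * (y - 1) * ((a + k) * (y + k)) * ((b + j) * (c + j)) * ((d + j) * (x + j)))
    - (b - a) * (c - a)
      * ((d - 1) * (x - 1) * ((d + k) * (x + k)) * ((a + j) * (y + j)) * ((b + j) * (c + j)))
    - (a - d) * (s - a - d)
      * ((b - 1) * (c - 1) * ((b + k) * (c + k)) * ((a + j) * (y + j)) * ((d + j) * (x + j)))
    = (b - d) * (c - d) * ((b - a) * (c - a)) * ((a - d) * (s - a - d))
      * ((1 + j) * (s - 1 + j)) * (k * (k + s) - j * (j + s)).
  (* The factors (a - 1) (y - 1) and their analogues are the shift t = -1, which gives w = (-1) (-1
     + s) = 1 - s. *)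
  have -> : (1 + j) * (s - 1 + j) = j * (j + s) - (-1) * (-1 + s) by ring.
  rewrite bd ba' ad !quad !bE; exact: lagrange_combination.
rewrite /sh /ba !invfM !invrK.
(* The weights are not assumed nonzero; with their inverses as indeterminates, [field] asks for no
   condition on them. *)
move: (wx^-1) (wa^-1) (wb^-1) => vx va vb.
(* Every factor becomes an indeterminate, so that [field] meets monomials only. *)
move: key am bm cm dm xm ym ak bk xk aj bj xj c0 d0 y0 {sh ba quad bE bd ba' ad}.
move: (b - d) (c - d) (b - a) (c - a) (a - d) (s - a - d).
move: (a - 1) (b - 1) (c - 1) (d - 1) (x - 1) (y - 1).
move: (a + m) (b + m) (c + m) (d + m) (x + m) (y + m).
move: (a + k) (b + k) (c + k) (d + k) (x + k) (y + k).
move: (a + j) (b + j) (c + j) (d + j) (x + j) (y + j).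
move: (1 + j) (s - 1 + j) (k * (k + s) - j * (j + s)).
move: x y => x y {s m}.
move=> z1 z2 z3 aj bj cj dj xj yj ak bk ck dk xk yk am bm cm dm xm ym.
move=> a1 b1 c1 d1 x1 y1 t1 t2 t3 t4 t5 t6 key.
move=> am0 bm0 cm0 dm0 xm0 ym0 ak0 bk0 xk0 aj0 bj0 xj0 c0 d0 y0.
transitivity (wy * wc * wd * (vx * va * vb) * (x * a * b)
    / (xm * am * bm * (ak * aj * (bk * bj) * (xk * xj)))
  * (t1 * t2 * (a1 * y1 * (ak * yk) * (bj * cj) * (dj * xj))
    - t3 * t4 * (d1 * x1 * (dk * xk) * (aj * yj) * (bj * cj))
    - t5 * t6 * (b1 * c1 * (bk * ck) * (aj * yj) * (dj * xj)))).
  by field; rewrite am0 bm0 cm0 dm0 xm0 ym0 ak0 bk0 xk0 aj0 bj0 xj0 c0 d0 y0.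
by rewrite key; field; rewrite am0 bm0 xm0 ak0 bk0 xk0 aj0 bj0 xj0.
Qed.

(** Up to a common factor this is (B - D) (A + p) - (B - A) (D + p) = (A - D) (B + p) with A = a y,
    B = b c, D = d x and p = n (n + s): the combination kills the affine function z + p. *)
Lemma last_combination (a b c d n : K) :
  let s := b + c in let y := s - a in let x := s - d in
  a + n != 0 -> b + n != 0 -> x + n != 0 ->
  a + n - 1 != 0 -> b + n - 1 != 0 -> c + n - 1 != 0 ->
  d + n - 1 != 0 -> x + n - 1 != 0 -> y + n - 1 != 0 ->
  c != 0 -> d != 0 -> y != 0 -> c - 1 != 0 -> d - 1 != 0 -> y - 1 != 0 ->
  let sh u := (u + n) * (u + n - 1) / (u * (u - 1)) in
  (b - d) * (c - d) * ((a - 1) * a) * ((y - 1) * y) / ((a + n - 1) * (y + n - 1))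
    * ((sh x)^-1 * sh y * (sh b)^-1)
  - (b - a) * (c - a) * ((d - 1) * d) * ((x - 1) * x) / ((d + n - 1) * (x + n - 1))
    * (sh d * (sh a)^-1 * (sh b)^-1)
  = (a - d) * (s - a - d) * ((b - 1) * b) * ((c - 1) * c) / ((b + n - 1) * (c + n - 1))
    * ((sh x)^-1 * sh c * (sh a)^-1).
Proof.
move=> s y x an bn xn an1 bn1 cn1 dn1 xn1 yn1 c0 d0 y0 c1 d1 y1 sh.
(* Inverting the ratios moves a - 1, b - 1 and x - 1, which may vanish, into numerators. *)
rewrite /sh !invf_div; subst s y x; field.
by rewrite an bn xn an1 bn1 cn1 dn1 xn1 yn1 c0 d0 y0 c1 d1 y1.
Qed.

(** The case n = 0, where each series is 1: the prefactors reduce to (B - D) A - (B - A) D = (A - D)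
    B. *)
Lemma empty_combination (a b c d : K) :
  let s := b + c in let y := s - a in let x := s - d in
  a - 1 != 0 -> b - 1 != 0 -> c - 1 != 0 ->
  d - 1 != 0 -> x - 1 != 0 -> y - 1 != 0 ->
  (b - d) * (c - d) * ((a - 1) * a) * ((y - 1) * y) / ((a - 1) * (y - 1))
  - (b - a) * (c - a) * ((d - 1) * d) * ((x - 1) * x) / ((d - 1) * (x - 1))
  = (a - d) * (s - a - d) * ((b - 1) * b) * ((c - 1) * c) / ((b - 1) * (c - 1)).
Proof.
move=> s y x a1 b1 c1 d1 x1 y1; subst s y x; field.
by rewrite a1 b1 c1 d1 x1 y1.
Qed.

(** Adding the sum to its reversal gives twice the sum; a central term k = j is covered as well. *)
Lemma sum_antisymmetric (h : nat -> K) n : 2%:R != 0 :> K ->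
  (forall k j, (k + j).+1 = n -> h k + h j = 0) -> \sum_(k < n) h k = 0.
Proof.
move=> two_neq0 hanti; apply/eqP; rewrite -(mulIr_eq0 _ (mulIf two_neq0)).
apply/eqP; rewrite -natr1 mulrDr mulr1 {2}(reindex_inj rev_ord_inj) -big_split /=.
by apply: big1 => k _; rewrite hanti // -addSn subnKC.
Qed.

End RationalIdentities.

(** * Pochhammer symbols and the ratios contributed by paired parameters *)

Section Pochhammer.
Import numFieldNormedType.Exports.
Variable K : numFieldType.
Implicit Types (u v w : K) (k m n : nat).

Lemma pochhammer0 u : pochhammer u 0 = 1.
Proof. exact: big_ord0. Qed.

Lemma pochhammerSr u k : pochhammer u k.+1 = pochhammer u k * (u + k%:R).
Proof. exact: big_ord_recr. Qed.

Lemma pochhammerSl u k : pochhammer u k.+1 = u * pochhammer (u + 1) k.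
Proof.
rewrite /pochhammer big_ord_recl addr0; congr (_ * _).
by apply: eq_bigr => i _; rewrite lift0 -natr1; ring.
Qed.

Lemma pochhammer2 u : pochhammer u 2 = u * (u + 1).
Proof. by rewrite !pochhammerSr pochhammer0 mul1r addr0. Qed.

Lemma pochhammerD u m k :
  pochhammer u (m + k) = pochhammer u m * pochhammer (u + m%:R) k.
Proof.
elim: k => [|k IH]; first by rewrite addn0 pochhammer0 mulr1.
by rewrite addnS !pochhammerSr IH natrD; ring.
Qed.

Lemma pochhammer_reflect u k :
  pochhammer (1 - u - k%:R) k = (-1) ^+ k * pochhammer u k.
Proof.
elim: k u => [|k IH] u; first by rewrite !pochhammer0 expr0 mulr1.
rewrite pochhammerSr (_ : 1 - u - k.+1%:R = 1 - (u + 1) - k%:R); last first.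
  by rewrite -natr1; ring.
by rewrite IH pochhammerSl exprS; ring.
Qed.

Lemma pochhammer1 k : pochhammer (1 : K) k = k`!%:R.
Proof.
elim: k => [|k IH]; first by rewrite pochhammer0.
by rewrite pochhammerSr IH factS natrM -natr1; ring.
Qed.

Lemma pochhammer_oppn n k : (n < k)%N -> pochhammer (- n%:R : K) k = 0.
Proof.
move=> nk; rewrite /pochhammer (bigD1 (Ordinal nk)) //=.
by rewrite addNr mul0r.
Qed.

Lemma pochhammer_neq0_le u m k :
  (m <= k)%N -> pochhammer u k != 0 -> pochhammer u m != 0.
Proof.
by move=> /subnKC <-; rewrite pochhammerD mulf_eq0 negb_or => /andP[].
Qed.

(** The contribution of an upper parameter u and a lower parameter v to the k-th term, with one of
    the t signs of the argument (-1)^t assigned to the pair. *)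
Definition signed_ratio u v k : K :=
  (-1) ^+ k * (pochhammer u k / pochhammer v k).

Lemma signed_ratio0 u v : signed_ratio u v 0 = 1.
Proof. by rewrite /signed_ratio !pochhammer0 expr0 divr1 mulr1. Qed.

Lemma signed_ratioV u v k : signed_ratio v u k = (signed_ratio u v k)^-1.
Proof. by rewrite /signed_ratio invfM invf_div -exprVn invrN1. Qed.

(** As k! = (1)_k, an extra lower parameter 1 makes the two lists equally long; it is paired with
    the head of [us], later -n. *)
Lemma hypergeometric_term_ratio (us vs : seq K) k :
  size us = (size vs).+1 ->
  hypergeometric_term us vs ((-1) ^+ size us) k =
  \prod_(p <- zip us (1 :: vs)) signed_ratio p.1 p.2 k.
Proof.
move=> sz; rewrite /hypergeometric_term -pochhammer1.
have swap (x y z t : K) : x / y * (z / t) = z * x / (t * y).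
  by rewrite invfM mulrACA [x * z]mulrC [y^-1 * _]mulrC.
rewrite swap -(big_cons _ _ 1 vs xpredT (fun w => pochhammer w k)) -exprM mulnC exprM.
have /eqP : size us = size (1 :: vs) by [].
elim: us (1 :: vs) {sz} => [|u us IH] [|v vs'] //=.
  by rewrite !big_nil mulr1 divr1.
by rewrite eqSS => /IH E; rewrite !big_cons -E /signed_ratio exprS invfM /=; ring.
Qed.

Lemma hypergeometric_oppn n (us vs : seq K) z : - n%:R \in us ->
  hypergeometric us vs z = \sum_(k < n.+1) hypergeometric_term us vs z k.
Proof.
move=> Hn; rewrite /hypergeometric; apply: (@cvg_lim K); first exact: norm_hausdorff.
(* The partial sums are constant from index n + 1 on. *)
apply: cvg_near_cst; exists n.+1 => // m /= nm.
rewrite /series /= (big_cat_nat (n := n.+1)) //= big_mkord.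
rewrite [X in _ + X]big1_seq ?addr0 // => i /andP[_].
rewrite mem_index_iota => /andP[ni _].
rewrite /hypergeometric_term [X in X / _](_ : _ = 0) ?mul0r //.
apply/eqP; rewrite prodf_seq_eq0; apply/hasP; exists (- n%:R) => //=.
by rewrite pochhammer_oppn.
Qed.

Lemma lower_defined_neq0 n (vs : seq K) v :
  lower_defined n vs -> v \in vs -> pochhammer v n != 0.
Proof.
by move=> /(_ n (leqnn n)); rewrite prodf_seq_neq0 => /allP H /H.
Qed.

(** Since w = 1 - (v + m) - k, reflection turns (w)_k into (v + m)_k up to the sign, and (v + m)_k =
    (v)_(m + k) / (v)_m. *)
Lemma signed_ratio_reflect u v w m k : w = 1 - v - (m + k)%:R ->
  pochhammer v (m + k) != 0 ->
  signed_ratio u w k = pochhammer u k * pochhammer v m / pochhammer v (m + k).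
Proof.
move=> ->; rewrite pochhammerD mulf_eq0 negb_or => /andP[vm vk].
rewrite /signed_ratio (_ : 1 - v - (m + k)%:R = 1 - (v + m%:R) - k%:R); last first.
  by rewrite natrD; ring.
have sk : (-1) ^+ k != 0 :> K by rewrite expf_neq0 // oppr_eq0 oner_eq0.
by rewrite pochhammer_reflect; field; rewrite vm vk sk.
Qed.

(** For k + j = n - 1, the part of a ratio that is symmetric in k and j; the denominator is then
    (u)_n. *)
Definition weight u k j : K :=
  pochhammer u k * pochhammer u j / pochhammer u (k + j).+1.

Lemma weightC u k j : weight u j k = weight u k j.
Proof. by rewrite /weight addnC [pochhammer u j * _]mulrC. Qed.

(** With n = k + j + 1, a pair of sum 1 - n. Reflection leaves (u)_(j + 1) = (u)_j (u + j), whose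
    last factor breaks the symmetry. *)
Lemma signed_ratio_balanced u w k j : w = 1 - u - (k + j).+1%:R ->
  pochhammer u (k + j).+1 != 0 ->
  signed_ratio u w k = weight u k j * (u + j%:R).
Proof.
rewrite -addnS addnC => -> un; rewrite (signed_ratio_reflect _ _ _ _ _ (erefl _)) //.
by rewrite /weight pochhammerSr addSn [(j + k)%N]addnC; ring.
Qed.

(** A pair of sum 3 - n, n = k + j + 1. The asymmetric factor u + k comes from (u + 1)_k = (u)_k (u
    + k) / u, and u + (k + j) from completing (u)_(k + j) to (u)_n. *)
Lemma signed_ratio_shifted u u' w k j : u' = u + 1 -> w = 1 - u - (k + j)%:R ->
  pochhammer u (k + j).+1 != 0 ->
  signed_ratio u' w k = weight u k j * (u + k%:R) * (u + (k + j)%:R) / u.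
Proof.
move=> -> wE un; have u0 : u != 0.
  by move: un; rewrite pochhammerSl mulf_eq0 negb_or => /andP[].
have [n0 m0] : pochhammer u (k + j) != 0 /\ u + (k + j)%:R != 0.
  by move: un; rewrite pochhammerSr mulf_eq0 negb_or => /andP[].
rewrite (signed_ratio_reflect _ u _ j) 1?addnC //.
have -> : pochhammer (u + 1) k = pochhammer u k * (u + k%:R) / u.
  by rewrite -pochhammerSr pochhammerSl mulrAC mulfV // mul1r.
rewrite /weight [pochhammer u (k + j).+1]pochhammerSr.
by field; rewrite -natrD u0 n0 m0.
Qed.

(** A pair of sum 2 - n, n = k + j + 1: reflection gives (u)_k (u)_j / (u)_(k + j) with no factor
    left over. *)
Lemma signed_ratio_sym u w k j : w = 1 - u - (k + j)%:R ->
  pochhammer u (k + j) != 0 -> signed_ratio u w k = signed_ratio u w j.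
Proof.
move=> wE un; rewrite (signed_ratio_reflect _ u _ j) 1?addnC //.
rewrite (signed_ratio_reflect _ u _ k) //.
by rewrite [pochhammer u j * _]mulrC ?[(j + k)%N]addnC.
Qed.

Lemma signed_ratio_last u n : pochhammer u n != 0 ->
  signed_ratio u (1 - u - n%:R) n = 1.
Proof.
move=> un; rewrite (signed_ratio_reflect _ u _ 0) //.
by rewrite pochhammer0 mulr1 divff.
Qed.

(** Meant for u = b + c: the factor s - 1 + j that [inner_combination] leaves is exactly what makes
    this ratio symmetric in k and j. *)
Lemma signed_ratio_gap2 (u w : K) k j : w = 2 - u - (k + j)%:R ->
  pochhammer (u - 1) (k + j) != 0 ->
  signed_ratio u w k * (u - 1 + j%:R) =
  pochhammer u k * pochhammer u j * (u - 1) / pochhammer (u - 1) (k + j).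
Proof.
move=> wE un; rewrite (signed_ratio_reflect _ (u - 1) _ j) 1?addnC //; last by rewrite wE; ring.
have: pochhammer (u - 1) j * (u - 1 + j%:R) = (u - 1) * pochhammer u j.
  by rewrite -pochhammerSr pochhammerSl subrK.
by rewrite mulrAC -[_ * _ * (u - 1 + _)]mulrA => ->; rewrite addnC; ring.
Qed.

(* For u = 1 both sides are 0 by the convention 0^-1 = 0; this case does occur,
   as the parameters a, b and b + c - d may be equal to 1. *)
Lemma signed_ratio_shifted_last (u u' w : K) n : u' = u + 1 -> w = 2 - u - n%:R ->
  pochhammer u n != 0 -> u != 0 -> u + n%:R - 1 != 0 ->
  signed_ratio u' w n = (u + n%:R) * (u + n%:R - 1) / (u * (u - 1)).
Proof.
move=> -> -> un u0 un1.
have Pr : pochhammer (u + 1) n = pochhammer u n * (u + n%:R) / u.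
  by rewrite -pochhammerSr pochhammerSl mulrAC mulfV // mul1r.
have Pl : pochhammer (u - 1) n = (u - 1) * pochhammer u n / (u + n%:R - 1).
  have := pochhammerSl (u - 1) n; rewrite subrK => <-.
  by rewrite pochhammerSr addrAC mulfK.
rewrite /signed_ratio (_ : 2 - u - n%:R = 1 - (u - 1) - n%:R); last by ring.
rewrite pochhammer_reflect Pr Pl.
have [->|u1] := eqVneq (u - 1) 0; first by rewrite !(mul0r, mulr0, invr0).
have sk : (-1) ^+ n != 0 :> K by rewrite expf_neq0 // oppr_eq0 oner_eq0.
by field; rewrite u0 u1 un un1 sk.
Qed.

(** * The contribution of the parameters e and f *)

Definition tail_ratio (e f : seq K) n k : K :=
  (\prod_(x <- e) signed_ratio x (2 - x - n%:R) k)
  * \prod_(x <- f) signed_ratio (2 - x - n%:R) x k.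

Lemma tail_ratio0 (e f : seq K) n : tail_ratio e f n 0 = 1.
Proof. by rewrite /tail_ratio !big1 ?mulr1 // => x _; rewrite signed_ratio0. Qed.

(** The two hypotheses differ because e enters the lower list as 2 - x - n = 1 - (x - 1) - n and f
    as x itself. Both (x - 1)_n and (x)_n contain (x)_(n - 1), which the symmetry requires. *)
Lemma tail_ratio_sym (e f : seq K) n k j : (k + j).+1 = n ->
  {in e, forall x, pochhammer (x - 1) n != 0} ->
  {in f, forall x, pochhammer x n != 0} ->
  tail_ratio e f n k = tail_ratio e f n j.
Proof.
move=> nE he hf; rewrite /tail_ratio.
have sym x : pochhammer x (k + j) != 0 ->
    signed_ratio x (2 - x - n%:R) k = signed_ratio x (2 - x - n%:R) j.
  move=> xm; apply: signed_ratio_sym xm.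
  by rewrite -nE -natr1; ring.
congr (_ * _); apply: eq_big_seq => x.
  move=> /he xn; apply: sym; move: xn.
  by rewrite -nE pochhammerSl subrK mulf_eq0 negb_or => /andP[].
move=> /hf xn; rewrite !(signed_ratioV x) sym //; move: xn.
by rewrite -nE pochhammerSr mulf_eq0 negb_or => /andP[].
Qed.

Lemma hypergeometric_term_tail (us vs e f : seq K) n k : size us = (size vs).+1 ->
  hypergeometric_term (us ++ e ++ [seq 2 - x - n%:R | x <- f])
    (vs ++ [seq 2 - x - n%:R | x <- e] ++ f) ((-1) ^+ (size e + size f + size us)) k
  = (\prod_(p <- zip us (1 :: vs)) signed_ratio p.1 p.2 k) * tail_ratio e f n k.
Proof.
move=> sz; set us' := us ++ _; set vs' := vs ++ _.
have -> : (size e + size f + size us)%N = size us'.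
  by rewrite /us' !size_cat size_map addnC.
rewrite hypergeometric_term_ratio; last first.
  by rewrite /us' /vs' !size_cat !size_map sz.
rewrite /us' /vs' -cat_cons zip_cat // zip_cat ?size_map // !big_cat /=.
congr (_ * (_ * _)).
  by elim: e {us' vs'} => [|x e IH]; rewrite /= ?big_nil // !big_cons /= IH.
by elim: f {us' vs'} => [|x f IH]; rewrite /= ?big_nil // !big_cons /= IH.
Qed.

(** * The relation between the three finite sums *)

Lemma terms_relation n (a b c d : K) (S : nat -> K) :
  let y := b + c - a in let x := b + c - d in
  let an := 1 - a - n%:R in let bn := 1 - b - n%:R in
  let cn := 1 - c - n%:R in let dn := 1 - d - n%:R in
  let us1 := [:: - n%:R; bn - c + d + 1; y + 1; c; d; an; bn + 1; b + c] in
  let vs1 := [:: x + 1; bn - c + a + 1; cn; dn; a; b + 1; bn - c + 2] in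
  let us2 := [:: - n%:R; bn - c + d; y; c; d + 1; an + 1; bn + 1; b + c] in
  let vs2 := [:: x; bn - c + a; cn; dn + 1; a + 1; b + 1; bn - c + 2] in
  let us3 := [:: - n%:R; bn - c + d + 1; y; c + 1; d; an + 1; bn; b + c] in
  let vs3 := [:: x + 1; bn - c + a; cn + 1; dn; a + 1; b; bn - c + 2] in
  let term us vs k := (\prod_(p <- zip us (1 :: vs)) signed_ratio p.1 p.2 k) * S k in
  (0 < n)%N ->
  pochhammer x n.+1 != 0 -> pochhammer a n.+1 != 0 -> pochhammer b n.+1 != 0 ->
  pochhammer (y - 1) n.+1 != 0 -> pochhammer (c - 1) n.+1 != 0 ->
  pochhammer (d - 1) n.+1 != 0 -> pochhammer (b + c - 2) n != 0 ->
  (forall k j, (k + j).+1 = n -> S k = S j) ->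
  (b - d) * (c - d) * ((a - 1) * a) * ((y - 1) * y)
    / ((a + n%:R - 1) * (y + n%:R - 1)) * \sum_(k < n.+1) term us1 vs1 k
  - (b - a) * (c - a) * ((d - 1) * d) * ((x - 1) * x)
    / ((d + n%:R - 1) * (x + n%:R - 1)) * \sum_(k < n.+1) term us2 vs2 k
  = (a - d) * (b + c - a - d) * ((b - 1) * b) * ((c - 1) * c)
    / ((b + n%:R - 1) * (c + n%:R - 1)) * \sum_(k < n.+1) term us3 vs3 k.
Proof.
move=> y x an bn cn dn us1 vs1 us2 vs2 us3 vs3 term n_gt0.
move=> xn1 an1 bn1 yn1 cn1 dn1 sn Ssym.
(* [upper] serves y, c, d, whose reflections 1 - u - n and 2 - u - n are lower parameters; [lower]
   serves x, a, b, where u and u + 1 are lower parameters themselves. *)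
have upper u : pochhammer (u - 1) n.+1 != 0 -> u - 1 != 0 /\ pochhammer u n != 0.
  by rewrite pochhammerSl subrK mulf_eq0 negb_or => /andP[].
have lower u : pochhammer u n.+1 != 0 -> pochhammer u n != 0 /\ u + n%:R != 0.
  by rewrite pochhammerSr mulf_eq0 negb_or => /andP[].
have [y1 yn] := upper _ yn1; have [c1 c_n] := upper _ cn1.
have [d1 d_n] := upper _ dn1; have [xn xpn] := lower _ xn1.
have [a_n apn] := lower _ an1; have [b_n bpn] := lower _ bn1.
have poch1 m : pochhammer (1 : K) m != 0 by rewrite pochhammer1 pnatr_eq0 -lt0n fact_gt0.
have factor u i : (i < n)%N -> pochhammer u n != 0 -> u + i%:R != 0.
  move=> i_n /(pochhammer_neq0_le _ i.+1 _ i_n).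
  by rewrite pochhammerSr mulf_eq0 negb_or => /andP[].
have factor0 u : pochhammer u n != 0 -> u != 0.
  by move=> /(factor _ 0 n_gt0); rewrite addr0.
have factor1 u : pochhammer u n != 0 -> u + n%:R - 1 != 0.
  case: (n) n_gt0 factor => // m _ /(_ _ m (ltnSn m)) H /H.
  by rewrite -natr1 addrA addrK.
set pre1 := _ / ((a + n%:R - 1) * _); set pre2 := _ / ((d + n%:R - 1) * _).
set pre3 := _ / ((b + n%:R - 1) * _).
pose h k := pre1 * term us1 vs1 k - pre2 * term us2 vs2 k - pre3 * term us3 vs3 k.
have [x1E x2E] : bn - c + d = 1 - x - n%:R /\ bn - c + d + 1 = 2 - x - n%:R.
  by rewrite /bn /x; split; ring.
have [y1E y2E] : bn - c + a = 1 - y - n%:R /\ bn - c + a + 1 = 2 - y - n%:R.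
  by rewrite /bn /y; split; ring.
have shiftE u : 1 - u - n%:R + 1 = 2 - u - n%:R by ring.
(* The pairs -n, 1 and b + c, 3 - b - c - n, as well as [S k], are common to the three terms. *)
have hE k : h k =
    signed_ratio (- n%:R) 1 k * signed_ratio (b + c) (bn - c + 2) k * S k *
    (pre1 * (signed_ratio (2 - x - n%:R) (x + 1) k *
             signed_ratio (y + 1) (2 - y - n%:R) k *
             signed_ratio c (1 - c - n%:R) k * signed_ratio d (1 - d - n%:R) k *
             signed_ratio (1 - a - n%:R) a k *
             signed_ratio (2 - b - n%:R) (b + 1) k)
     - pre2 * (signed_ratio (1 - x - n%:R) x k * signed_ratio y (1 - y - n%:R) k *
             signed_ratio c (1 - c - n%:R) k * signed_ratio (d + 1) (2 - d - n%:R) k *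
             signed_ratio (2 - a - n%:R) (a + 1) k * signed_ratio (2 - b - n%:R) (b + 1) k)
     - pre3 * (signed_ratio (2 - x - n%:R) (x + 1) k * signed_ratio y (1 - y - n%:R) k *
             signed_ratio (c + 1) (2 - c - n%:R) k * signed_ratio d (1 - d - n%:R) k *
             signed_ratio (2 - a - n%:R) (a + 1) k * signed_ratio (1 - b - n%:R) b k)).
  rewrite /h /term /= !big_cons big_nil /= x2E x1E y2E y1E.
  rewrite /an /cn /dn /bn !shiftE; ring.
(* The reflection-invariant cofactor of p - q, with k + j standing for n - 1: the symmetric parts of
   the two common pairs, [S k], and the quotient produced by [inner_combination]. *)
pose g k j : K := (weight 1 k j)^-1
  * (pochhammer (b + c) k * pochhammer (b + c) j * (b + c - 1)
     / pochhammer (b + c - 1) (k + j)) * S k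
  * (weight y k j * weight c k j * weight d k j
      / (weight x k j * weight a k j * weight b k j)
     * (x * a * b * (b - d) * (c - d) * (b - a) * (c - a) * (a - d) * (b + c - a - d))
     / ((x + (k%:R + j%:R)) * (a + (k%:R + j%:R)) * (b + (k%:R + j%:R))
        * ((a + k%:R) * (a + j%:R) * ((b + k%:R) * (b + j%:R))
           * ((x + k%:R) * (x + j%:R))))).
have g_sym k j : (k + j).+1 = n -> g j k = g k j.
  move=> nE; rewrite /g (Ssym _ _ nE) ![weight _ j k]weightC [(j + k)%N]addnC.
  by rewrite [j%:R + k%:R]addrC; congr (_^-1 * (_ / _) * _ * (_ / _)); ring.
have hpair k j : (k + j).+1 = n ->
    h k = g k j * (k%:R * (k%:R + (b + c)) - j%:R * (j%:R + (b + c))).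
  move=> nE; have nR : n%:R = k%:R + j%:R + 1 :> K by rewrite -nE -natr1 natrD.
  have balE u : pochhammer u n != 0 ->
      signed_ratio u (1 - u - n%:R) k = weight u k j * (u + j%:R).
    by move=> un; apply: signed_ratio_balanced; rewrite nE.
  have shE u : pochhammer u n != 0 -> signed_ratio (u + 1) (2 - u - n%:R) k =
      weight u k j * (u + k%:R) * (u + (k%:R + j%:R)) / u.
    move=> un; rewrite -natrD; apply: signed_ratio_shifted => //.
      by rewrite nR natrD; ring.
    by rewrite nE.
  have balVE u : pochhammer u n != 0 -> signed_ratio (1 - u - n%:R) u k =
      (weight u k j * (u + j%:R))^-1.
    by move=> un; rewrite signed_ratioV balE.
  have shVE u : pochhammer u n != 0 -> signed_ratio (2 - u - n%:R) (u + 1) k =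
      (weight u k j * (u + k%:R) * (u + (k%:R + j%:R)) / u)^-1.
    by move=> un; rewrite signed_ratioV shE.
  (* The pair -n, 1 is the inverse of the balanced pair with u = 1, as 1 - 1 - n = -n. *)
  have oneE : signed_ratio (- n%:R) 1 k = (weight 1 k j * (1 + j%:R))^-1.
    by rewrite -balVE // subrr sub0r.
  have topE u : u + n%:R - 1 = u + (k%:R + j%:R) by rewrite nR; ring.
  have [kn jn] : (k < n)%N /\ (j < n)%N.
    by rewrite -nE !ltnS leq_addr leq_addl.
  rewrite hE oneE (shE _ yn) (shE _ c_n) (shE _ d_n) (shVE _ xn) (shVE _ a_n) (shVE _ b_n).
  rewrite (balE _ yn) (balE _ c_n) (balE _ d_n) (balVE _ xn) (balVE _ a_n) (balVE _ b_n).
  rewrite /pre1 /pre2 /pre3 !topE.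
  rewrite inner_combination; first last.
  all: try (rewrite -topE; exact: factor1).
  all: try exact: factor0.
  all: try exact: factor.
  have j1 : 1 + j%:R != 0 :> K by rewrite nat1r pnatr_eq0.
  rewrite /g -(signed_ratio_gap2 (b + c) (bn - c + 2) k j); first last.
  - rewrite (_ : b + c - 1 = b + c - 2 + 1); last by ring.
    by move: sn; rewrite -nE pochhammerSl mulf_eq0 negb_or => /andP[].
  - by rewrite /bn nR natrD; ring.
  (* The factor 1 + j cancels against the pair -n, 1, while s - 1 + j has been absorbed by the pair
     of b + c. *)
  have cancel1 (w o s t u z q : K) : o != 0 ->
      (w * o)^-1 * s * t * (u * o * z * q) = w^-1 * (s * z) * t * u * q.
    by move=> o0; rewrite invfM; move: (w^-1) => v; field.
  exact: cancel1.
have hsum : \sum_(k < n.+1) h k = 0.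
  (* The reflection acts on k < n only. At k = n the balanced ratios are 1 and the shifted ones are
     [sh u], so [last_combination] applies. *)
  rewrite big_ord_recr /= (sum_antisymmetric _ h) ?pnatr_eq0 // ?add0r.
    rewrite hE; set sh := fun u => (u + n%:R) * (u + n%:R - 1) / (u * (u - 1)).
    have balE u : pochhammer u n != 0 -> signed_ratio u (1 - u - n%:R) n = 1.
      exact: signed_ratio_last.
    have shE u : pochhammer u n != 0 ->
        signed_ratio (u + 1) (2 - u - n%:R) n = sh u.
      move=> un; exact: signed_ratio_shifted_last (factor0 _ un) (factor1 _ un).
    have balVE u : pochhammer u n != 0 -> signed_ratio (1 - u - n%:R) u n = 1.
      by move=> un; rewrite signed_ratioV balE // invr1.
    have shVE u : pochhammer u n != 0 ->
        signed_ratio (2 - u - n%:R) (u + 1) n = (sh u)^-1.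
      by move=> un; rewrite signed_ratioV shE.
    rewrite (shE _ yn) (shE _ c_n) (shE _ d_n) (shVE _ xn) (shVE _ a_n) (shVE _ b_n).
    rewrite (balE _ yn) (balE _ c_n) (balE _ d_n) (balVE _ xn) (balVE _ a_n) (balVE _ b_n).
    rewrite !mulr1 !mul1r.
    apply/eqP; rewrite mulf_eq0 subr_eq0; apply/orP; right; apply/eqP.
    by apply: last_combination => //; first [exact: factor0 | exact: factor1].
  move=> k j nE; rewrite (hpair k j nE) (hpair j k); last by rewrite addnC.
  by rewrite (g_sym k j nE); ring.
apply/eqP; rewrite -subr_eq0 !mulr_sumr -!sumrB; apply/eqP.
exact: hsum.
Qed.

(** * From well-defined series to the nonvanishing conditions, and the theorem *)

Lemma pochhammer_reflect_neq0 (u w : K) n : w = 1 - u - n%:R ->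
  pochhammer w n != 0 -> pochhammer u n != 0.
Proof. by move=> ->; rewrite pochhammer_reflect mulf_eq0 negb_or => /andP[]. Qed.

(** Joins conditions from two series in which a parameter occurs as u and as u + 1; n > 0 makes u a
    factor of (u)_n. *)
Lemma pochhammer_neq0_glue (u : K) n : (0 < n)%N ->
  pochhammer u n != 0 -> pochhammer (u + 1) n != 0 -> pochhammer u n.+1 != 0.
Proof.
case: n => // n _ un u1n; rewrite pochhammerSl mulf_neq0 //.
by move: un; rewrite pochhammerSl mulf_eq0 negb_or => /andP[].
Qed.

Lemma hypergeometric_tail (us vs e f : seq K) n t :
  - n%:R \in us -> size us = (size vs).+1 -> t = (size e + size f + size us)%N ->
  hypergeometric (us ++ e ++ [seq 2 - x - n%:R | x <- f])
    (vs ++ [seq 2 - x - n%:R | x <- e] ++ f) ((-1) ^+ t)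
  = \sum_(k < n.+1)
      (\prod_(p <- zip us (1 :: vs)) signed_ratio p.1 p.2 k) * tail_ratio e f n k.
Proof.
move=> n_us sz ->; rewrite (hypergeometric_oppn n) ?mem_cat ?n_us //.
by apply: eq_bigr => k _; rewrite hypergeometric_term_tail.
Qed.

End Pochhammer.

Theorem theorem6p6 (R : realType) (r s n : nat) (a b c d : R[i])
    (e : r.-tuple R[i]) (f : s.-tuple R[i]) :
  let t := (r + s + 8)%N in
  let an := 1 - a - n%:R in
  let bn := 1 - b - n%:R in
  let cn := 1 - c - n%:R in
  let dn := 1 - d - n%:R in
  let e' := [seq 2 - x - n%:R | x <- e] in
  let f' := [seq 2 - x - n%:R | x <- f] in
  let U1 := [:: - n%:R; bn - c + d + 1; b + c - a + 1; c; d; an; bn + 1; b + c]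
            ++ e ++ f' in
  let V1 := [:: b + c - d + 1; bn - c + a + 1; cn; dn; a; b + 1; bn - c + 2]
            ++ e' ++ f in
  let U2 := [:: - n%:R; bn - c + d; b + c - a; c; d + 1; an + 1; bn + 1; b + c]
            ++ e ++ f' in
  let V2 := [:: b + c - d; bn - c + a; cn; dn + 1; a + 1; b + 1; bn - c + 2]
            ++ e' ++ f in
  let U3 := [:: - n%:R; bn - c + d + 1; b + c - a; c + 1; d; an + 1; bn; b + c]
            ++ e ++ f' in
  let V3 := [:: b + c - d + 1; bn - c + a; cn + 1; dn; a + 1; b; bn - c + 2]
            ++ e' ++ f in
  lower_defined n V1 -> lower_defined n V2 -> lower_defined n V3 ->
  (a + n%:R - 1) * (b + c - a + n%:R - 1) != 0 ->
  (d + n%:R - 1) * (b + c - d + n%:R - 1) != 0 ->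
  (b + n%:R - 1) * (c + n%:R - 1) != 0 ->
  (b - d) * (c - d) * pochhammer (a - 1) 2 * pochhammer (b + c - a - 1) 2
    / ((a + n%:R - 1) * (b + c - a + n%:R - 1))
    * hypergeometric U1 V1 ((-1) ^+ t)
  - (b - a) * (c - a) * pochhammer (d - 1) 2 * pochhammer (b + c - d - 1) 2
    / ((d + n%:R - 1) * (b + c - d + n%:R - 1))
    * hypergeometric U2 V2 ((-1) ^+ t)
  = (a - d) * (b + c - a - d) * pochhammer (b - 1) 2 * pochhammer (c - 1) 2
    / ((b + n%:R - 1) * (c + n%:R - 1))
    * hypergeometric U3 V3 ((-1) ^+ t).
Proof.
move=> t an bn cn dn e' f' U1 V1 U2 V2 U3 V3 def1 def2 def3 adef ddef bdef.
have two (u : R[i]) : pochhammer (u - 1) 2 = (u - 1) * u.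
  by rewrite pochhammer2 subrK.
rewrite !two /U1 /V1 /U2 /V2 /U3 /V3.
rewrite !(hypergeometric_tail _ _ _ e f n t) ?size_tuple ?inE ?eqxx //.
(* For n = 0 the Pochhammer symbols are empty and say nothing about the parameters; the conditions
   come from the denominators of the prefactors. *)
have [n0|n_gt0] := posnP n.
  move: adef ddef bdef; rewrite !mulf_eq0 !negb_or n0 !addr0.
  move=> /andP[a1 y1] /andP[d1 x1] /andP[b1 c1].
  rewrite !big_ord1 !tail_ratio0 /= !big_cons !big_nil !signed_ratio0 !mulr1.
  exact: empty_combination.
have in1 v : v \in V1 -> pochhammer v n != 0 by exact: lower_defined_neq0.
have in2 v : v \in V2 -> pochhammer v n != 0 by exact: lower_defined_neq0.
have in3 v : v \in V3 -> pochhammer v n != 0 by exact: lower_defined_neq0.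
have reflect_last (u w : R[i]) : w = 1 - u - n%:R -> pochhammer w n != 0 -> pochhammer u n != 0.
  exact: pochhammer_reflect_neq0.
apply: terms_relation => //; rewrite -/an -/bn -/cn -/dn.
- by apply: pochhammer_neq0_glue => //; [apply: in2 | apply: in1]; rewrite !inE eqxx ?orbT.
- by apply: pochhammer_neq0_glue => //; [apply: in1 | apply: in2]; rewrite !inE eqxx ?orbT.
- by apply: pochhammer_neq0_glue => //; [apply: in3 | apply: in1]; rewrite !inE eqxx ?orbT.
(* For y, c and d the gluing starts at u - 1, and the lower parameters 2 - u - n and 1 - u - n are
   the reflections of u - 1 and u. *)
- apply: pochhammer_neq0_glue; rewrite ?subrK //.
    apply: (reflect_last _ (bn - c + a + 1)); first by rewrite /bn; ring.
    by apply: in1; rewrite !inE eqxx ?orbT.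
  apply: (reflect_last _ (bn - c + a)); first by rewrite /bn; ring.
  by apply: in2; rewrite !inE eqxx ?orbT.
- apply: pochhammer_neq0_glue; rewrite ?subrK //.
    apply: (reflect_last _ (cn + 1)); first by rewrite /cn; ring.
    by apply: in3; rewrite !inE eqxx ?orbT.
  apply: (reflect_last _ cn) => //.
  by apply: in1; rewrite !inE eqxx ?orbT.
- apply: pochhammer_neq0_glue; rewrite ?subrK //.
    apply: (reflect_last _ (dn + 1)); first by rewrite /dn; ring.
    by apply: in2; rewrite !inE eqxx ?orbT.
  apply: (reflect_last _ dn) => //.
  by apply: in1; rewrite !inE eqxx ?orbT.
(* The lower parameter 3 - b - c - n is the reflection of b + c - 2. *)
- apply: (reflect_last _ (bn - c + 2)); first by rewrite /bn; ring.
  by apply: in1; rewrite !inE eqxx ?orbT.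
move=> k j nE; apply: tail_ratio_sym => // z z_in.
  apply: (reflect_last _ (2 - z - n%:R)); first by ring.
  apply: in1; rewrite !mem_cat; apply/or3P; apply: Or32.
  exact: (map_f (fun x => 2 - x - n%:R) z_in).
by apply: in1; rewrite !mem_cat z_in !orbT.
Qed.
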